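(* Let $n\ge 5$. Among all polyomino chains with $n$ squares, the chains maximizing the augmented Zagreb index $AZI$ are exactly: the chain $AZ^1_{(n-1)/2}$ when $n$ is odd, and the chains of the family $AZ^2_{n/2}$ when $n$ is even. Moreover, the maximum value is $$M(n)=\frac{4456}{125}n-\frac{26763}{2000}-\frac{2312}{3375}\,I_{\{n\text{ even}\}},$$ where $I_{\{n\text{ even}\}}$ equals $1$ if $n$ is even and $0$ otherwise.
   Context: Polyomino chains (restricted model). For $n\ge 2$, a polyomino chain with $n$ squares is a sequence of closed unit squares $S_1,\dots,S_n$ in the plane with $S_1=[0,1]\times[0,1]$, $S_2=[1,2]\times[0,1]$, and for $k\ge 3$, $S_k=S_{k-1}+v_k$, where $v_2=(1,0)$ and each $v_k\in\{(1,0),(0,-1)\}$ satisfies $v_k=v_{k-1}$ if $L_k=1$ and $v_k\neq v_{k-1}$ if $L_k=2$. For $n\ge3$ the chain is determined by its link vector $(L_3,\dots,L_n)\in\{1,2\}^{n-2}$ and denoted $PC(L_3,\dots,L_n)$. Each chain is regarded as the graph whose vertices are the corners of the squares and whose edges are the sides of the squares. The augmented Zagreb index is $AZI(G)=\sum_{uv\in E(G)}\left(\frac{d_ud_v}{d_u+d_v-2}\right)^3$, where $d_u$ is the degree of $u$. Segments: a segment of a chain is a maximal run of consecutive squares $S_a,S_{a+1},\dots,S_b$ ($b>a$) lying in a common row or a common column; consecutive segments share exactly one square (a kink, where the chain changes direction), so a chain with $m$ segments of lengths (numbers of squares) $l_1,\dots,l_m$ satisfies $\sum l_i=n+m-1$.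 A segment is external if it contains $S_1$ or $S_n$, and internal otherwise. $AZ^1_m$ ($m\ge2$) denotes the polyomino chain with $m$ segments all of length 3; $AZ^2_m$ ($m\ge3$) denotes the family of polyomino chains with $m$ segments all of length 3 except exactly one internal segment of length 2. *)

(* Defs.v *)
From mathcomp Require Export all_boot all_order all_algebra.

Set Implicit Arguments.
Unset Strict Implicit.
Unset Printing Implicit Defensive.

Import Order.TTheory GRing.Theory Num.Theory.

Local Open Scope ring_scope.

Definition point : Type := (int * int)%type.

(* The closed unit square [x, x+1] * [y, y+1] is represented by its lower-left
   corner (x, y), and a chain S_1, ..., S_n by the sequence of its squares;
   S_k is thus the item of index k - 1. *)
Definition chain : Type := seq point.

Definition right : point := (1, 0).
Definition down : point := (0, -1).

Definition other_dir (v : point) : point := if v == right then down else right.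

(* [s] is the current square S_{k-1}, [v] the last displacement v_{k-1}, and
   [L] the list of the remaining links L_k, ..., L_n. *)
Fixpoint squares_from (s v : point) (L : seq nat) : chain :=
  if L is l :: L' then
    let v' := if l == 1%N then v else other_dir v in
    s :: squares_from (s.1 + v'.1, s.2 + v'.2) v' L'
  else [:: s].

Definition link_vector (n : nat) (L : seq nat) : bool :=
  ((size L).+2 == n) && all [pred l | (l == 1%N) || (l == 2)] L.

Definition PC (L : seq nat) : chain := (0, 0) :: squares_from (1, 0) right L.

Definition polyomino_chain (n : nat) (c : chain) : Prop :=
  exists2 L : seq nat, link_vector n L & c = PC L.

(* An undirected side is stored once, with its lower or left endpoint first, so
   that a side shared by two squares has a single representation. *)
Definition sides (s : point) : seq (point * point) :=
  let: (x, y) := s in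
  [:: ((x, y), (x + 1, y)); ((x, y + 1), (x + 1, y + 1));
      ((x, y), (x, y + 1)); ((x + 1, y), (x + 1, y + 1))].

(* The vertices of the graph are the corners, i.e., the endpoints of the edges. *)
Definition edges (c : chain) : seq (point * point) :=
  undup (flatten [seq sides s | s <- c]).

Definition deg (c : chain) (u : point) : nat :=
  count [pred e : point * point | (e.1 == u) || (e.2 == u)] (edges c).

(* All terms of the sum are rational, so the index takes its values in rat. *)
Definition AZI (c : chain) : rat :=
  \sum_(e <- edges c)
    (((deg c e.1)%:R * (deg c e.2)%:R)
       / ((deg c e.1)%:R + (deg c e.2)%:R - 2)) ^+ 3.

(* A run of consecutive squares is given by the pair (a, b) of the 0-based
   indices of its first and last squares. *)
Definition squares_of (c : chain) (r : nat * nat) : seq point :=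
  drop r.1 (take r.2.+1 c).

Definition aligned_run (c : chain) (r : nat * nat) : bool :=
  [&& (r.1 < r.2)%N, (r.2 < size c)%N
    & constant [seq s.1 | s <- squares_of c r]
      || constant [seq s.2 | s <- squares_of c r]].

Definition runs (c : chain) : seq (nat * nat) :=
  [seq r <- [seq (a, b) | a <- iota 0 (size c), b <- iota 0 (size c)]
     | aligned_run c r].

Definition segments (c : chain) : seq (nat * nat) :=
  [seq r <- runs c
     | all [pred r' | (r'.1 <= r.1)%N && (r.2 <= r'.2)%N ==> (r' == r)] (runs c)].

Definition seg_length (r : nat * nat) : nat := (r.2 - r.1).+1.

Definition external (c : chain) (r : nat * nat) : bool :=
  (r.1 == 0%N) || (r.2 == (size c).-1).

Definition internal (c : chain) (r : nat * nat) : bool := ~~ external c r.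

Definition AZ1 (m : nat) (c : chain) : Prop :=
  [/\ exists n, polyomino_chain n c,
      size (segments c) = m
    & forall r, r \in segments c -> seg_length r = 3].

Definition AZ2 (m : nat) (c : chain) : Prop :=
  [/\ exists n, polyomino_chain n c,
      size (segments c) = m
    & exists r, [/\ r \in segments c, internal c r, seg_length r = 2
      & forall r', r' \in segments c -> r' <> r -> seg_length r' = 3]].

Definition maximizes_AZI (n : nat) (c : chain) : Prop :=
  polyomino_chain n c /\
  forall c', polyomino_chain n c' -> AZI c' <= AZI c.

(* 4456/125 n - 26763/2000 - 2312/3375 I_{n even}; 26763 is split because a
   numeral of that size overflows the stack (numerals are unary here). *)
Definition maxAZI (n : nat) : rat :=
  4456 / 125 * n%:R - (26 * 1000 + 763) / 2000 - 2312 / 3375 * (~~ odd n)%:R.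

(* Main.v *)
(* Each step of a chain raises x - y by one, so a corner of a square only meets
   squares of the next two levels.  Hence prepending a square to a chain changes
   a degree-based index by an amount that depends only on the first four squares,
   and AZI is an affine function of n minus a cost: 3829/4000 for a turn at the
   second or at the last but one square, 2312/3375 for two consecutive turns and
   11809/8000 for two consecutive non-turns.  Read off the segments, the cost is
   a sum of penalties that vanish exactly for the segments of length 3.  If n is
   even, not all segments have length 3, and the cheapest defect is a single
   internal segment of length 2. *)
Require Import Defs.
From mathcomp Require Import zify ring lra.

Set Implicit Arguments.
Unset Strict Implicit.
Unset Printing Implicit Defensive.

Import Order.TTheory GRing.Theory Num.Theory.

Section DegreeIndex.

Local Open Scope ring_scope.

Variables (V : zmodType) (f : nat -> nat -> V).

Definition index_on (P : pred (point * point)) (c : chain) : V :=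
  \sum_(e <- edges c | P e) f (deg c e.1) (deg c e.2).

Definition degree_index (c : chain) : V :=
  \sum_(e <- edges c) f (deg c e.1) (deg c e.2).

Definition edge_degrees (c : chain) : seq (nat * nat) :=
  [seq (deg c e.1, deg c e.2) | e <- edges c].

Lemma degree_index_edge_degrees (c : chain) :
  degree_index c = \sum_(ij <- edge_degrees c) f ij.1 ij.2.
Proof. by rewrite big_map. Qed.

Lemma degree_index_split (P : pred (point * point)) (c : chain) :
  degree_index c = index_on P c + index_on (predC P) c.
Proof. exact: bigID. Qed.

Definition incident (u : point) : pred (point * point) :=
  [pred e | (e.1 == u) || (e.2 == u)].

Lemma edgesP (c : chain) (e : point * point) :
  reflect (exists2 s : point, s \in c & e \in sides s) (e \in edges c).
Proof. by rewrite mem_undup; apply: flatten_mapP. Qed.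

Lemma mem_edges_cat (a b : chain) (e : point * point) :
  (e \in edges (a ++ b)) = (e \in edges a) || (e \in edges b).
Proof. by rewrite !mem_undup map_cat flatten_cat mem_cat. Qed.

Lemma eq_deg (c c' : chain) (u : point) :
  {in incident u, edges c =i edges c'} -> deg c u = deg c' u.
Proof.
move=> eq_cc'; rewrite /deg -!size_filter -/(incident u); apply/perm_size/uniq_perm.
- exact/filter_uniq/undup_uniq.
- exact/filter_uniq/undup_uniq.
by move=> e; rewrite !mem_filter; case u_e: (incident u e) => //=; exact: eq_cc'.
Qed.

Lemma eq_index_on (P : pred (point * point)) (c c' : chain) :
  (forall e e' : point * point, e \in edges (c ++ c') -> P e ->
     incident e.1 e' || incident e.2 e' ->
     (e' \in edges c) = (e' \in edges c')) ->
  index_on P c = index_on P c'.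
Proof.
move=> eq_cc'; rewrite /index_on -big_filter -[RHS]big_filter.
have eq_edges : perm_eq [seq e <- edges c | P e] [seq e <- edges c' | P e].
  apply: uniq_perm; rewrite ?filter_uniq ?undup_uniq // => e.
  rewrite !mem_filter; case Pe: (P e) => //=.
  have := eq_cc' e e; rewrite mem_edges_cat /incident /= eqxx.
  by case: (e \in edges c) (e \in edges c') => -[] // /(_ isT Pe isT).
rewrite (perm_big _ eq_edges) /=.
apply: eq_big_seq => e; rewrite mem_filter => /andP[Pe e_in].
have e_cc' : e \in edges (c ++ c') by rewrite mem_edges_cat e_in orbT.
congr f; apply: eq_deg => e' e'_in; apply: (eq_cc' e) => //.
  by apply/orP; left.
by apply/orP; right.
Qed.

Definition level (p : point) : int := p.1 - p.2.

Lemma level_sides (s : point) (e : point * point) : e \in sides s ->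
  [/\ level s - 1 <= level e.1 <= level s + 1,
      level s - 1 <= level e.2 <= level s + 1
    & level e.1 - 1 <= level e.2 <= level e.1 + 1].
Proof.
case: s => x y; rewrite !inE /level => /or4P[] /eqP-> /=;
by split; apply/andP; split; lia.
Qed.

Lemma incident_level (u : point) (e : point * point) :
  incident u e -> level u = level e.1 \/ level u = level e.2.
Proof. by case/orP => /eqP->; [left | right]. Qed.

Definition above (l : int) : pred (point * point) :=
  [pred e | (l < level e.1) && (l < level e.2)].

Lemma index_on_above (s : point) (b : chain) :
  index_on (above (level s + 1)) (s :: b) = index_on (above (level s + 1)) b.
Proof.
apply: eq_index_on => e e' _ /andP[lt1 lt2] e_e'.
rewrite -cat1s mem_edges_cat; case: (boolP (e' \in edges [:: s])) => //=.
case/edgesP => _ /[1!inE] /eqP-> /level_sides[/andP[_ le1] /andP[_ le2] _].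
by case/orP: e_e' => /incident_level[]; lia.
Qed.

Lemma index_on_below (l : int) (a b : chain) :
  {in b, forall s : point, l + 3 <= level s} ->
  index_on (predC (above l)) (a ++ b) = index_on (predC (above l)) a.
Proof.
move=> b_high; apply: eq_index_on => e e' /edgesP[s _].
case/level_sides => _ _ /andP[le12 le21] /=.
rewrite negb_and -!leNgt => low e_e'.
rewrite mem_edges_cat orbC; case: (boolP (e' \in edges b)) => //=.
case/edgesP => s' /b_high high /level_sides[/andP[ge1 _] /andP[ge2 _] _].
by case/orP: low => low; case/orP: e_e' => /incident_level[]; lia.
Qed.

(* A corner of [s] only meets squares whose level exceeds that of [s] by at
   most 2, so the edges affected by adding [s] have no endpoint on [b]. *)
Lemma degree_index_cons (s : point) (a b : chain) :
  {in b, forall s' : point, level s + 4 <= level s'} ->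
  degree_index (s :: a ++ b)
  = degree_index (a ++ b) + (degree_index (s :: a) - degree_index a).
Proof.
move=> b_high; rewrite !(degree_index_split (above (level s + 1))).
rewrite !index_on_above -cat_cons !index_on_below; last 2 first.
- by move=> s' /b_high; lia.
- by move=> s' /b_high; lia.
by rewrite [in RHS](addrC _ (index_on _ (s :: a))) addrKA -[RHS]addrA subrKC.
Qed.

Lemma point_addE (p q : point) : p + q = (p.1 + q.1, p.2 + q.2).
Proof. by []. Qed.

Definition shift_edge (v : point) (e : point * point) : point * point :=
  (e.1 + v, e.2 + v).

Lemma shift_edge_inj (v : point) : injective (shift_edge v).
Proof.
by apply: (can_inj (g := shift_edge (- v))) => -[p q]; rewrite /shift_edge !addrK.
Qed.

Lemma edges_shift (v : point) (c : chain) :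
  edges [seq p + v | p <- c] = map (shift_edge v) (edges c).
Proof.
rewrite /edges -(undup_map_inj (@shift_edge_inj v)) map_flatten -!map_comp.
congr (undup (flatten _)); apply: eq_map => -[x y] /=.
by rewrite /shift_edge /= !point_addE /= !(addrAC _ 1).
Qed.

Lemma deg_shift (v : point) (c : chain) (u : point) :
  deg [seq p + v | p <- c] (u + v) = deg c u.
Proof.
rewrite /deg edges_shift count_map; apply: eq_count => e /=.
by rewrite !(inj_eq (@addIr _ v)).
Qed.

Lemma degree_index_shift (v : point) (c : chain) :
  degree_index [seq p + v | p <- c] = degree_index c.
Proof.
rewrite /degree_index edges_shift big_map.
by apply: eq_bigr => e _; rewrite !deg_shift.
Qed.

End DegreeIndex.

Section Walks.

Local Open Scope ring_scope.

Definition step (d : bool) : point := if d then down else right.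

Definition walk (p : point) (ds : seq bool) : chain :=
  p :: scanl (fun q d => q + step d) p ds.

(* The item of index i of [t] tells whether the walk turns at its square of
   index i + 1, and [d] is its first direction. *)
Definition turning_walk (p : point) (d : bool) (t : seq bool) : chain :=
  walk p (d :: scanl addb d t).

Definition staircase (t : seq bool) : chain := turning_walk 0 false t.

Lemma squares_from_walk (p : point) (d : bool) (L : seq nat) :
  squares_from p (step d) L = walk p (scanl addb d [seq l != 1%N | l <- L]).
Proof.
elim: L p d => //= l L IH p d; rewrite /walk /= -/(walk _ _) -IH.
by case: (l == 1%N); case: d.
Qed.

Lemma PC_staircase (L : seq nat) : PC L = staircase [seq l != 1%N | l <- L].
Proof. by rewrite /PC -[right]/(step false) squares_from_walk. Qed.

Lemma size_staircase (t : seq bool) : size (staircase t) = (size t).+2.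
Proof. by rewrite /= !size_scanl. Qed.

Lemma polyomino_chainP (n : nat) (c : chain) :
  polyomino_chain n c <-> exists2 t, (size t).+2 = n & c = staircase t.
Proof.
split=> [[L /andP[/eqP <- _] ->]|[t <- ->]].
  by exists [seq l != 1%N | l <- L]; rewrite ?size_map ?PC_staircase.
pose L := [seq if a then 2 else 1%N | a <- t].
exists L; first by rewrite /link_vector size_map eqxx all_map; apply/allP => -[].
by rewrite PC_staircase -map_comp map_id_in // => -[].
Qed.

Lemma level_step (d : bool) (p : point) : level (p + step d) = level p + 1.
Proof. by case: p d => x y []; rewrite point_addE /level /=; lia. Qed.

Lemma level_walk (p s : point) (ds : seq bool) :
  s \in walk p ds -> level p <= level s.
Proof.
elim: ds p => [|d ds IH] p; rewrite in_cons => /predU1P[->|] //=.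
by move/IH; rewrite level_step; lia.
Qed.

Lemma walk_shift (v p : point) (ds : seq bool) :
  walk (p + v) ds = [seq q + v | q <- walk p ds].
Proof.
rewrite /walk /=; congr (_ :: _).
by elim: ds p => //= d ds IH p; rewrite -IH addrAC.
Qed.

Lemma degree_index_walk (V : zmodType) (f : nat -> nat -> V) (p : point)
    (ds : seq bool) :
  degree_index f (walk p ds) = degree_index f (walk 0 ds).
Proof. by rewrite -[p in LHS]add0r walk_shift degree_index_shift. Qed.

Lemma degree_index_turning_walk_cons (V : zmodType) (f : nat -> nat -> V)
    (p : point) (d a b : bool) (t : seq bool) :
  let q := p + step d in let d' := d (+) a in
  degree_index f (turning_walk p d [:: a, b & t])
  = degree_index f (turning_walk q d' (b :: t))
    + (degree_index f (turning_walk p d [:: a; b])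
       - degree_index f (turning_walk q d' [:: b])).
Proof.
move=> q d'; pose q2 := q + step d'; pose q3 := q2 + step (d' (+) b).
have [r tail_r r_high] : exists2 r,
    walk q3 (scanl addb (d' (+) b) t) = q3 :: r
    & {in r, forall s : point, level p + 4 <= level s}.
  case: t => [|x t]; first by exists [::].
  exists (walk (q3 + step (d' (+) b (+) x)) (scanl addb (d' (+) b (+) x) t)) => //.
  by move=> s /level_walk; rewrite /q3 /q2 /q !level_step; lia.
have := degree_index_cons f [:: q; q2; q3] r_high.
by case: tail_r => <-.
Qed.

End Walks.

Section Segments.

Lemma mem_pairmap_pair (T : eqType) (r : rel T) (x u v : T) (s : seq T) :
  irreflexive r -> transitive r -> path r x s ->
  (u, v) \in pairmap pair x s <->
  [/\ u \in x :: s, v \in s, r u v & forall w, w \in s -> r u w -> ~~ r w v].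
Proof.
move=> r_irr r_tr; elim: s x => [|y s IHs] x /=; first by split=> // -[].
case/andP=> r_xy /[dup] y_s /IHs{}IHs; have y_lt := allP (order_path_min r_tr y_s).
have y_min w : w \in y :: s -> ~~ r w y.
  case/predU1P=> [->|/y_lt r_yw]; first by rewrite r_irr.
  by apply/negP => /(r_tr _ _ _ r_yw); rewrite r_irr.
split=> [/predU1P[[-> ->]|/IHs[u_ys v_s r_uv no_w]]|].
- by split; rewrite ?in_cons ?eqxx // => w /y_min.
- split=> //; [by rewrite in_cons u_ys orbT | by rewrite in_cons v_s orbT |].
  by move=> w /predU1P[->|/no_w//]; rewrite (negPf (y_min u u_ys)).
case=> /predU1P[->|u_ys] /predU1P[->|v_s] r_uv no_w; apply/predU1P.
- by left.
- by have := no_w y (mem_head _ _) r_xy; rewrite y_lt.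
- by have := y_min u u_ys; rewrite r_uv.
by right; apply/IHs; split=> // w w_s; apply: no_w; rewrite in_cons w_s orbT.
Qed.

Lemma take_scanl (T1 T2 : Type) (g : T1 -> T2 -> T1) (x : T1) (s : seq T2)
    (n : nat) :
  take n (scanl g x s) = scanl g x (take n s).
Proof. by elim: s x n => [|y s IHs] x [|n] //=; rewrite IHs. Qed.

Lemma drop_cons_scanl (T1 T2 : Type) (g : T1 -> T2 -> T1) (x : T1) (s : seq T2)
    (n : nat) :
  n <= size s ->
  drop n (x :: scanl g x s)
  = foldl g x (take n s) :: scanl g (foldl g x (take n s)) (drop n s).
Proof. by elim: s x n => [|y s IHs] x [|n] //= /IHs->. Qed.

Lemma constant_map_walk (g : point -> int) (p : point) (ds : seq bool) :
  {morph g : q q' / (q + q')%R} ->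
  constant [seq g q | q <- walk p ds] = all (fun d => g (step d) == 0%R) ds.
Proof.
move=> gD; rewrite /walk /=; elim: ds p => //= d ds IHds p.
rewrite -(IHds (p + step d)%R) gD -subr_eq0 addrAC subrr add0r.
by case: eqP => // ->; rewrite addr0.
Qed.

Lemma aligned_walk (p : point) (ds : seq bool) :
  constant [seq q.1 | q <- walk p ds] || constant [seq q.2 | q <- walk p ds]
  = constant ds.
Proof.
rewrite !constant_map_walk //.
by case: ds => //= -[] ds /=; rewrite ?orbF; apply: eq_all => -[].
Qed.

Lemma constant_scanl_addb (d : bool) (t : seq bool) :
  constant (d :: scanl addb d t) = all negb t.
Proof.
by elim: t d => //= -[] t IHt d; case: d => //=; rewrite -IHt.
Qed.

Lemma squares_of_turning_walk (p : point) (d : bool) (t : seq bool) (a b : nat) :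
  a <= b <= size t ->
  exists q d', squares_of (turning_walk p d t) (a, b.+1)
               = turning_walk q d' (drop a (take b t)).
Proof.
case/andP=> le_ab le_bt; have size_b : size (take b t) = b by rewrite size_takel.
rewrite -[squares_of _ _]/
  (drop a (p :: take b.+1 (scanl _ p (d :: scanl addb d t)))).
rewrite take_scanl -[take b.+1 _]/(d :: take b (scanl addb d t)) take_scanl.
rewrite drop_cons_scanl /= ?size_scanl ?size_b 1?leqW //.
by rewrite drop_cons_scanl ?size_b //; eexists; eexists.
Qed.

Lemma aligned_runE (t : seq bool) (a b : nat) :
  aligned_run (staircase t) (a, b)
  = [&& a < b, b <= (size t).+1 & all negb (drop a (take b.-1 t))].
Proof.
rewrite /aligned_run size_staircase ltnS.
case: b => // b; rewrite ltnS /=; case: leqP => //= le_ab; case: ltnP => //= lt_bt.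
have [|q [d ->]] := @squares_of_turning_walk 0%R false t a b; first exact/andP.
by rewrite aligned_walk constant_scanl_addb.
Qed.

(* The last squares of the segments, when [t] lists the turns at the squares
   from [k] on and the walk ends at the square k + size t. *)
Definition seg_ends (k : nat) (t : seq bool) : seq nat :=
  mask (rcons t true) (iota k (size t).+1).

Lemma seg_ends_cons (k : nat) (a : bool) (t : seq bool) :
  seg_ends k (a :: t) = nseq a k ++ seg_ends k.+1 t.
Proof. by case: a. Qed.

Lemma mem_seg_ends (k j : nat) (t : seq bool) :
  (j \in seg_ends k t) = (k <= j) && nth false (rcons t true) (j - k).
Proof.
rewrite in_mask ?iota_uniq // mem_iota; case: (leqP k j) => // le_kj.
rewrite !andTb; case: ltnP => [lt_j|ge_j]; last first.
  by rewrite [RHS]nth_default // size_rcons; lia.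
have lt_jk : j - k < (size t).+1 by lia.
by rewrite -[in index _ _](subnKC le_kj) -(nth_iota 0 k lt_jk) index_uniq
  ?size_iota ?iota_uniq.
Qed.

Lemma path_seg_ends (k : nat) (t : seq bool) : path ltn k (seg_ends k.+1 t).
Proof. exact: (path_mask ltn_trans _ (iota_ltn_sorted k (size t).+2)). Qed.

Lemma mem_seg_ends_turn (t : seq bool) (j : nat) :
  0 < j <= size t -> (j \in seg_ends 1 t) = nth false t j.-1.
Proof.
case: j => // j /= lt_jt; rewrite mem_seg_ends /= subn1 nth_rcons lt_jt //.
Qed.

Lemma last_seg_end (t : seq bool) : (size t).+1 \in seg_ends 1 t.
Proof. by rewrite mem_seg_ends subn1 nth_rcons ltnn eqxx. Qed.

Lemma seg_ends_bounds (t : seq bool) (j : nat) :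
  j \in seg_ends 1 t -> 0 < j <= (size t).+1.
Proof. by move/mem_mask; rewrite mem_iota add1n ltnS. Qed.

Lemma aligned_runP (t : seq bool) (a b : nat) :
  reflect [/\ a < b, b <= (size t).+1
            & forall j, a < j < b -> j \notin seg_ends 1 t]
    (aligned_run (staircase t) (a, b)).
Proof.
rewrite aligned_runE; apply: (iffP and3P) => -[lt_ab le_bt no_turn]; split=> //.
  case=> // j /andP[lt_aj lt_jb]; rewrite mem_seg_ends_turn /=; last by lia.
  have /(all_nthP false no_turn) : j - a < size (drop a (take b.-1 t)).
    by rewrite size_drop size_takel; lia.
  by rewrite nth_drop subnKC // nth_take //; lia.
apply/(all_nthP false) => i; rewrite size_drop size_takel; last by lia.
move=> lt_i; rewrite nth_drop nth_take; last by lia.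
rewrite -[a + i]/((a + i).+1.-1) -mem_seg_ends_turn; last by lia.
by apply: no_turn; lia.
Qed.

Lemma mem_runs (c : chain) (r : nat * nat) : (r \in runs c) = aligned_run c r.
Proof.
rewrite mem_filter; case run_r: (aligned_run c r) => //=.
case: r run_r => a b /and3P[/= lt_ab lt_bc _].
by apply/allpairsP; exists (a, b); rewrite !mem_iota /= lt_bc (ltn_trans lt_ab).
Qed.

Lemma segments_uniq (c : chain) : uniq (segments c).
Proof.
by rewrite !filter_uniq // allpairs_uniq ?iota_uniq // => -[? ?] [? ?].
Qed.

Lemma seg_length_gt1 (c : chain) (r : nat * nat) :
  r \in segments c -> 1 < seg_length r.
Proof.
rewrite mem_filter mem_runs => /andP[_ /and3P[lt_r _ _]].
by rewrite /seg_length ltnS subn_gt0.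
Qed.

Lemma run_between_seg_ends_maximal (t : seq bool) (a b a' b' : nat) :
  a \in 0 :: seg_ends 1 t -> b \in seg_ends 1 t -> a < b ->
  aligned_run (staircase t) (a', b') -> a' <= a -> b <= b' -> (a', b') = (a, b).
Proof.
move=> a_end b_end lt_ab /aligned_runP[_ _ no_end] le_aa le_bb.
congr pair; apply/eqP; rewrite eqn_leq ?le_aa ?le_bb ?andbT leqNgt; apply/negP.
  case/predU1P: a_end => [->|a_end] // lt_aa.
  by have /no_end/negP[] : a' < a < b' by rewrite lt_aa (leq_trans lt_ab).
move=> lt_bb.
by have /no_end/negP[] : a' < b < b' by rewrite lt_bb (leq_ltn_trans le_aa).
Qed.

Lemma mem_segments (t : seq bool) (a b : nat) :
  (a, b) \in segments (staircase t) <->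
  [/\ a \in 0 :: seg_ends 1 t, b \in seg_ends 1 t, a < b
    & forall j, a < j < b -> j \notin seg_ends 1 t].
Proof.
rewrite mem_filter mem_runs; split=> [/andP[/allP max_ab]|].
  case/aligned_runP=> lt_ab le_bt no_end; split=> //.
    rewrite in_cons; case: posnP => //= a_gt0; apply/negPn/negP => a_end.
    have: (a.-1, b) \in runs (staircase t).
      rewrite mem_runs; apply/aligned_runP; split=> // [|j lt_j]; first by lia.
      by case: (eqVneq j a) => [-> //|ne_ja]; apply: no_end; lia.
    by move/max_ab; rewrite /= leq_pred leqnn => /eqP[]; lia.
  apply/negPn/negP => b_end.
  have ne_bt : b != (size t).+1.
    by apply: contraNneq b_end => ->; exact: last_seg_end.
  have: (a, b.+1) \in runs (staircase t).
    rewrite mem_runs; apply/aligned_runP; split=> [||j lt_j]; [by lia | by lia |].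
    by case: (eqVneq j b) => [-> //|ne_jb]; apply: no_end; lia.
  by move/max_ab; rewrite /= leqnn leqnSn => /eqP[]; lia.
case=> a_end b_end lt_ab no_end; have /andP[_ le_bt] := seg_ends_bounds b_end.
apply/andP; split; last exact/aligned_runP.
apply/allP => -[a' b']; rewrite mem_runs => run_ab' /=.
apply/implyP => /andP[le_aa le_bb]; apply/eqP.
exact: run_between_seg_ends_maximal run_ab' le_aa le_bb.
Qed.

Lemma unzip2_pairmap_pair (T : Type) (x : T) (s : seq T) :
  unzip2 (pairmap pair x s) = s.
Proof. by elim: s x => //= y s IHs x; rewrite IHs. Qed.

Lemma perm_segments (t : seq bool) :
  perm_eq (segments (staircase t)) (pairmap pair 0 (seg_ends 1 t)).
Proof.
have end_path := path_seg_ends 0 t.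
apply: uniq_perm; rewrite ?segments_uniq //.
  apply: (@map_uniq _ _ snd); rewrite -/unzip2 unzip2_pairmap_pair.
  exact: sorted_uniq ltn_trans ltnn _ (path_sorted end_path).
case=> a b; apply/idP/idP => [/mem_segments[a_end b_end lt_ab no_end]|].
  apply/(mem_pairmap_pair _ _ ltnn ltn_trans end_path); split=> // j j_end lt_aj.
  by apply: contraL j_end => lt_jb; apply: no_end; rewrite lt_aj.
case/(mem_pairmap_pair _ _ ltnn ltn_trans end_path) => a_end b_end lt_ab no_end.
apply/mem_segments; split=> // j /andP[lt_aj lt_jb].
by apply/negP => /no_end/(_ lt_aj); rewrite lt_jb.
Qed.

End Segments.

Lemma sum_seg_length (t : seq bool) :
  \sum_(r <- segments (staircase t)) (seg_length r).-1 = (size t).+1.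
Proof.
rewrite (perm_big _ (perm_segments t)) /=.
suff sum_ends u k : u <= k ->
    \sum_(r <- pairmap pair u (seg_ends k t)) (r.2 - r.1) = k + size t - u.
  by rewrite sum_ends ?subn0.
elim: t u k => [|[] t IHt] u k le_uk; rewrite /seg_ends /= ?big_cons /=.
- by rewrite big_nil /=; lia.
- by rewrite IHt //; lia.
- by rewrite (IHt u k.+1) ?addSnnS // leqW.
Qed.

Lemma polyomino_sum_seg_length (n : nat) (c : chain) : polyomino_chain n c ->
  (\sum_(r <- segments c) (seg_length r).-1).+1 = n.
Proof. by case/polyomino_chainP => t <- ->; rewrite sum_seg_length. Qed.

Definition regular (c : chain) : bool :=
  all (fun r => seg_length r == 3) (segments c).

Lemma regularP (c : chain) :
  reflect (forall r, r \in segments c -> seg_length r = 3) (regular c).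
Proof. by apply: (iffP allP) => len3 r /len3/eqP. Qed.

Definition one_short_internal (c : chain) : Prop :=
  exists r, [/\ r \in segments c, internal c r, seg_length r = 2
    & forall r', r' \in segments c -> r' <> r -> seg_length r' = 3].

Lemma regular_size (n : nat) (c : chain) :
  polyomino_chain n c -> regular c -> n = (size (segments c)).*2.+1.
Proof.
move=> /polyomino_sum_seg_length <- /regularP len3; congr _.+1.
rewrite (eq_big_seq (fun=> 2)) => [|r /len3->] //.
by rewrite big_const_seq count_predT iter_addn_0 mul2n.
Qed.

Lemma one_short_internal_size (n : nat) (c : chain) :
  polyomino_chain n c -> one_short_internal c -> n = (size (segments c)).*2.
Proof.
move=> /polyomino_sum_seg_length <- [r [r_c _ r2 others3]].
rewrite -sum1_size -mul2n !(bigD1_seq r r_c (segments_uniq c)) r2 mulnDr big_distrr.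
congr _.+2; rewrite big_seq_cond [RHS]big_seq_cond.
by apply: eq_bigr => r' /andP[r'_c /eqP/(others3 r' r'_c)->].
Qed.

Lemma AZ1P (m : nat) (c : chain) :
  AZ1 m c <-> polyomino_chain m.*2.+1 c /\ regular c.
Proof.
split=> [[[n c_n] <- /regularP c_reg]|[c_m c_reg]].
  by rewrite -(regular_size c_n).
split; [| |exact/regularP]; first by exists m.*2.+1.
by have := regular_size c_m c_reg; lia.
Qed.

Lemma AZ2P (m : nat) (c : chain) :
  AZ2 m c <-> polyomino_chain m.*2 c /\ one_short_internal c.
Proof.
split=> [[[n c_n] <- c_short]|[c_m c_short]].
  by rewrite -(one_short_internal_size c_n).
split=> //; first by exists m.*2.
by have := one_short_internal_size c_m c_short; lia.
Qed.

(* All the segments have length 3, except that the second one has length 2 if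
   [n] is even. *)
Definition optimal_turns (n : nat) : seq bool :=
  [:: false, true, ~~ odd n & traject negb (odd n) (n - 5)].

Lemma size_optimal_turns (n : nat) :
  4 < n -> (size (optimal_turns n)).+2 = n.
Proof. by move=> n_gt4; rewrite /= size_traject; lia. Qed.

Lemma optimal_turns_polyomino (n : nat) :
  4 < n -> polyomino_chain n (staircase (optimal_turns n)).
Proof.
move/size_optimal_turns => size_n.
by apply/polyomino_chainP; exists (optimal_turns n).
Qed.

Lemma psumr_eq_gap (R : numDomainType) (I : eqType) (s : seq I) (F : I -> R)
    (m : R) :
  uniq s -> (0 < m)%R -> (forall i, 0 <= F i)%R ->
  {in s, forall i, F i != 0 -> m <= F i}%R ->
  (\sum_(i <- s) F i = m)%R <->
  exists i, [/\ i \in s, F i = m & {in s, forall j, j != i -> F j = 0%R}].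
Proof.
move=> s_uniq m_gt0 F_ge0 F_gap.
have sumD1 i : i \in s -> (\sum_(j <- s) F j = F i + \sum_(j <- s | j != i) F j)%R.
  by move=> i_s; rewrite (bigD1_seq i).
have rest_ge0 i : (0 <= \sum_(j <- s | j != i) F j)%R by exact: sumr_ge0.
split=> [sum_m|[i [i_s Fi others0]]]; last first.
  by rewrite (sumD1 i i_s) Fi big_seq_cond big1 ?addr0 // => j /andP[/others0].
have: (\sum_(j <- s) F j != 0)%R by rewrite sum_m gt_eqF.
rewrite psumr_eq0 // => /allPn[i i_s /= Fi_neq0]; exists i.
have Fi : F i = m.
  by apply/eqP; rewrite eq_le F_gap // andbT -sum_m (sumD1 i i_s) lerDl.
split=> //; have /eqP := sum_m.
rewrite (sumD1 i i_s) Fi -subr_eq0 addrAC subrr add0r.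
by rewrite psumr_eq0 // => /allP rest0 j /rest0 /implyP Fj0 /Fj0/eqP.
Qed.

Section Cost.

Local Open Scope ring_scope.

(* [short_ext] and [short_int] are the costs of an external and of an internal
   segment of length 2, and [excess] is the cost of every square of a segment
   beyond the third. *)
Variables (R : realDomainType) (short_ext short_int excess : R).

Definition penalty (is_ext : bool) (l : nat) : R :=
  (if is_ext then short_ext else short_int) *+ (l == 2)%N + excess *+ (l - 3).

Definition seg_cost (c : chain) : R :=
  \sum_(r <- segments c) penalty (external c r) (seg_length r).

Definition pair_cost (a b : bool) : R :=
  if a (+) b then 0 else if a then short_int else excess.

Fixpoint tail_cost (a : bool) (t : seq bool) : R :=
  if t is b :: t' then pair_cost a b + tail_cost b t' else short_ext *+ a.

Definition turn_cost (t : seq bool) : R :=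
  if t is a :: t' then short_ext *+ a + tail_cost a t' else 0.

Lemma turn_cost_cons2 (a b : bool) (t : seq bool) :
  turn_cost [:: a, b & t]
  = turn_cost (b :: t) + (turn_cost [:: a; b] - turn_cost [:: b]).
Proof. by rewrite /=; ring. Qed.

Lemma sum_penalty_seg_ends (u k : nat) (t : seq bool) :
  (u < k)%N -> (0 < u)%N || (u.+1 < k)%N ->
  \sum_(r <- pairmap pair u (seg_ends k t))
     penalty ((r.1 == 0)%N || (r.2 == k + size t)%N) (seg_length r)
  = excess *+ (k - u - 2) + tail_cost (k == u.+1) t.
Proof.
have short_seg a b : (a < b)%N -> ((b - a).+1 == 2)%N = (b == a.+1) by lia.
elim: t u k => [|[] t IHt] u k lt_uk away; rewrite ?seg_ends_cons ?big_cons.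
- rewrite /= big_nil addn0 eqxx orbT addr0 addrC.
  by rewrite /penalty /seg_length /= short_seg // subSS -subnDA.
- rewrite /= -addSnnS IHt //; last by lia.
  rewrite subSnn eqxx mulr0n add0r addrA; congr (_ + _).
  rewrite /penalty /seg_length /= short_seg //.
  rewrite (ltn_eqF (leq_addr (size t) k.+1)) orbF /pair_cost addrC; congr (_ + _).
  case: (eqVneq k u.+1) away => [->|_ _] //=.
  by rewrite ltnn orbF => /lt0n_neq0/negPf->.
- rewrite /= -addSnnS IHt ?ltnS ?lt_uk ?(ltnW lt_uk) ?orbT //.
  rewrite eqSS gtn_eqF // /pair_cost addrA; congr (_ + _).
  case: (eqVneq k u.+1) => [->|ne_uk] /=.
    by rewrite addr0; congr (excess *+ _); lia.
  by rewrite -mulrSr; congr (excess *+ _); lia.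
Qed.

Lemma seg_cost_staircase (t : seq bool) :
  (0 < size t)%N -> seg_cost (staircase t) = turn_cost t.
Proof.
rewrite /seg_cost /external size_staircase (perm_big _ (perm_segments t)) /=.
case: t => // a t _; rewrite seg_ends_cons /= -add2n; case: a => /=.
  rewrite big_cons sum_penalty_seg_ends //= /penalty /seg_length /=.
  by rewrite !mulr0n !addr0 add0r.
by rewrite sum_penalty_seg_ends //= mulr0n !add0r.
Qed.

Lemma tail_cost_traject (a : bool) (k : nat) :
  tail_cost a (traject negb (~~ a) k) = short_ext *+ (a (+) odd k).
Proof.
elim: k a => [|k IHk] a /=; first by rewrite addbF.
by rewrite IHk /pair_cost addbN addbb add0r addNb -addbN.
Qed.

Lemma turn_cost_optimal_turns (n : nat) :
  (4 < n)%N -> turn_cost (optimal_turns n) = short_int *+ ~~ odd n.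
Proof.
move=> n_gt4; have := tail_cost_traject (~~ odd n) (n - 5).
rewrite negbK oddB //= => ->; rewrite /pair_cost /= !add0r.
by case: (odd n); rewrite /= addr0.
Qed.

Variables (f : nat -> nat -> R) (slope offset : R).

Definition affine_index (n : nat) : R := slope * n%:R - offset.

Hypothesis index_short_walk : forall (p : point) (d : bool) (t : seq bool),
  (0 < size t <= 2)%N ->
  degree_index f (turning_walk p d t) = affine_index (size t).+2 - turn_cost t.

Lemma degree_index_turning_walk (p : point) (d : bool) (t : seq bool) :
  (0 < size t)%N ->
  degree_index f (turning_walk p d t) = affine_index (size t).+2 - turn_cost t.
Proof.
case: t => // a t _; elim: t p d a => [|b t IHt] p d a.
  exact: index_short_walk.
rewrite degree_index_turning_walk_cons IHt !index_short_walk // turn_cost_cons2.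
by rewrite /affine_index /= -(natr1 (size t).+3); ring.
Qed.

Lemma degree_index_seg_cost (n : nat) (c : chain) :
  (2 < n)%N -> polyomino_chain n c ->
  degree_index f c = affine_index n - seg_cost c.
Proof.
move=> n_gt2 /polyomino_chainP[t n_t ->]; have t_gt0 : (0 < size t)%N by lia.
by rewrite degree_index_turning_walk // seg_cost_staircase // n_t.
Qed.

Definition max_index (n : nat) : R := affine_index n - short_int *+ ~~ odd n.

Lemma degree_index_optimal_turns (n : nat) : (4 < n)%N ->
  degree_index f (staircase (optimal_turns n)) = max_index n.
Proof.
move=> n_gt4; rewrite degree_index_turning_walk // size_optimal_turns //.
by rewrite turn_cost_optimal_turns.
Qed.

Hypothesis short_int_gt0 : 0 < short_int.
Hypothesis short_int_lt_ext : short_int < short_ext.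
Hypothesis short_int_lt_excess : short_int < excess.

Let excess_gt0 : 0 < excess := lt_trans short_int_gt0 short_int_lt_excess.
Let short_ext_gt0 : 0 < short_ext := lt_trans short_int_gt0 short_int_lt_ext.

Lemma penalty_ge0 (is_ext : bool) (l : nat) : 0 <= penalty is_ext l.
Proof. by rewrite addr_ge0 ?mulrn_wge0 //; case: is_ext; rewrite ltW. Qed.

Lemma penalty3 (is_ext : bool) : penalty is_ext 3 = 0.
Proof. by rewrite /penalty addr0. Qed.

Lemma short_int_leif_penalty (is_ext : bool) (l : nat) : (1 < l)%N -> l != 3 ->
  short_int <= penalty is_ext l ?= iff ~~ is_ext && (l == 2)%N.
Proof.
case: l => [|[|[|[|l]]]] // _ _; apply/leifP; rewrite /penalty /=.
  by case: is_ext; rewrite addr0 mulr1n ?eqxx.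
by rewrite andbF add0r mulrS ltr_wpDr ?mulrn_wge0 // ltW.
Qed.

Lemma penalty_eq0 (is_ext : bool) (l : nat) :
  (1 < l)%N -> (penalty is_ext l == 0) = (l == 3).
Proof.
move=> l_gt1; case: (eqVneq l 3) => [->|l_ne3]; first by rewrite penalty3 eqxx.
have [le_short _] := short_int_leif_penalty is_ext l_gt1 l_ne3.
by rewrite gt_eqF // (lt_le_trans short_int_gt0).
Qed.

Lemma penalty_eq_short_int (is_ext : bool) (l : nat) :
  (1 < l)%N -> (penalty is_ext l == short_int) = ~~ is_ext && (l == 2).
Proof.
move=> l_gt1; case: (eqVneq l 3) => [->|l_ne3].
  by rewrite penalty3 lt_eqF // andbF.
by rewrite eq_sym; exact: eq_leif (short_int_leif_penalty _ l_gt1 l_ne3).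
Qed.

Lemma seg_cost_eq0 (c : chain) : (seg_cost c == 0) = regular c.
Proof.
rewrite psumr_eq0 => [|r _]; last exact: penalty_ge0.
by apply: eq_in_all => r /seg_length_gt1 /penalty_eq0->.
Qed.

Lemma seg_cost_ge_short_int (c : chain) : seg_cost c != 0 -> short_int <= seg_cost c.
Proof.
rewrite seg_cost_eq0 => /allPn[r r_c r_ne3].
have := short_int_leif_penalty (external c r) (seg_length_gt1 r_c) r_ne3.
rewrite /seg_cost (bigD1_seq r) ?segments_uniq //= => -[le_int _].
by rewrite ler_wpDr // sumr_ge0 // => r' _; exact: penalty_ge0.
Qed.

Lemma seg_cost_eq_short_int (c : chain) :
  seg_cost c = short_int <-> one_short_internal c.
Proof.
have gap : {in segments c, forall r, penalty (external c r) (seg_length r) != 0 ->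
    short_int <= penalty (external c r) (seg_length r)}.
  move=> r /seg_length_gt1 r_gt1; rewrite penalty_eq0 // => r_ne3.
  exact: (short_int_leif_penalty _ r_gt1 r_ne3).
rewrite /seg_cost psumr_eq_gap ?segments_uniq // => [|r]; last exact: penalty_ge0.
split=> [[r [r_c /eqP pen_r others0]]|[r [r_c r_int r2 others3]]]; exists r.
  move: pen_r; rewrite penalty_eq_short_int ?(seg_length_gt1 r_c) //.
  case/andP=> r_int /eqP r2.
  split=> // r' r'_c /eqP/(others0 _ r'_c)/eqP.
  by rewrite penalty_eq0 ?(seg_length_gt1 r'_c) // => /eqP.
split=> // [|r' r'_c /eqP/(others3 _ r'_c)->]; last exact: penalty3.
by apply/eqP; rewrite penalty_eq_short_int r2 // andbT.
Qed.

Lemma pair_cost_ge0 (a b : bool) : 0 <= pair_cost a b.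
Proof. by case: a; case: b; rewrite // ltW. Qed.

Lemma tail_cost_ge0 (a : bool) (t : seq bool) : 0 <= tail_cost a t.
Proof.
elim: t a => [|b t IHt] a; first by rewrite mulrn_wge0 // ltW.
by rewrite addr_ge0 ?pair_cost_ge0.
Qed.

Lemma tail_cost_eq0 (a : bool) (t : seq bool) :
  tail_cost a t = 0 -> t = traject negb (~~ a) (size t).
Proof.
elim: t a => //= b t IHt a /eqP; rewrite paddr_eq0 ?tail_cost_ge0 ?pair_cost_ge0 //.
case/andP=> ab0 /eqP/IHt {1}->; suff -> : b = ~~ a by [].
by case: a b ab0 => -[]; rewrite /pair_cost //= gt_eqF.
Qed.

Lemma turn_cost_eq0 (t : seq bool) :
  turn_cost t = 0 -> t = traject negb false (size t).
Proof.
case: t => //= a t /eqP; rewrite paddr_eq0 ?tail_cost_ge0 ?mulrn_wge0 ?ltW //.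
case/andP; case: a => [|_ /eqP/tail_cost_eq0 {1}->] //.
by rewrite mulr1n gt_eqF.
Qed.

Lemma regular_turns (t : seq bool) :
  (0 < size t)%N -> regular (staircase t) -> t = traject negb false (size t).
Proof.
by move=> t_gt0; rewrite -seg_cost_eq0 seg_cost_staircase // => /eqP/turn_cost_eq0.
Qed.

Lemma seg_cost_min (n : nat) (c : chain) :
  polyomino_chain n c -> short_int *+ ~~ odd n <= seg_cost c.
Proof.
move=> c_n; case: (boolP (odd n)) => [_|n_even].
  by apply: sumr_ge0 => r _; exact: penalty_ge0.
apply: seg_cost_ge_short_int; rewrite seg_cost_eq0; apply: contra n_even => c_reg.
by rewrite (regular_size c_n c_reg) /= odd_double.
Qed.

Lemma degree_index_le_max (n : nat) (c : chain) :
  (2 < n)%N -> polyomino_chain n c -> degree_index f c <= max_index n.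
Proof.
move=> n_gt2 c_n.
by rewrite (degree_index_seg_cost n_gt2) // lerD2l lerN2 seg_cost_min.
Qed.

Lemma degree_index_eq_max_odd (n : nat) (c : chain) :
  (2 < n)%N -> odd n -> polyomino_chain n c ->
  degree_index f c = max_index n <-> regular c.
Proof.
move=> n_gt2 n_odd c_n; rewrite (degree_index_seg_cost n_gt2) // /max_index n_odd.
by rewrite -seg_cost_eq0; split=> [/addrI/oppr_inj/eqP|/eqP->].
Qed.

Lemma degree_index_eq_max_even (n : nat) (c : chain) :
  (2 < n)%N -> ~~ odd n -> polyomino_chain n c ->
  degree_index f c = max_index n <-> one_short_internal c.
Proof.
move=> n_gt2 n_even c_n; rewrite (degree_index_seg_cost n_gt2) // /max_index n_even.
by rewrite -seg_cost_eq_short_int; split=> [/addrI/oppr_inj|->].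
Qed.

End Cost.

Lemma regular_unique (n : nat) (c c' : chain) :
  2 < n -> polyomino_chain n c -> polyomino_chain n c' ->
  regular c -> regular c' -> c = c'.
Proof.
move=> n_gt2 /polyomino_chainP[t n_t ->] /polyomino_chainP[t' n_t' ->].
have turnsE u : (size u).+2 = n -> regular (staircase u) ->
    u = traject negb false n.-2.
  (* Any admissible costs will do. *)
  by move=> n_u; rewrite -n_u; apply: (@regular_turns int 2 1 2) => //; lia.
by move=> /(turnsE t n_t)-> /(turnsE t' n_t')->.
Qed.

Section AugmentedZagreb.

Local Open Scope ring_scope.

Definition edge_weight (i j : nat) : rat :=
  ((i%:R * j%:R) / (i%:R + j%:R - 2)) ^+ 3.

Lemma AZI_degree_index (c : chain) : AZI c = degree_index edge_weight c.
Proof. by []. Qed.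

Lemma edge_weightC (i j : nat) : edge_weight i j = edge_weight j i.
Proof. by rewrite /edge_weight [i%:R * _]mulrC [i%:R + _]addrC. Qed.

Lemma edge_weight2 (j : nat) : edge_weight 2 j.+1 = 8.
Proof.
have j_neq0 : j.+1%:R != 0 :> rat by rewrite pnatr_eq0.
by rewrite /edge_weight [2 + _]addrC addrK mulfK //; ring.
Qed.

Lemma edge_weight33 : edge_weight 3 3 = 729 / 64.
Proof. by rewrite /edge_weight; field. Qed.

Lemma edge_weight34 : edge_weight 3 4 = 1728 / 125.
Proof. by rewrite /edge_weight; field. Qed.

Lemma edge_weight44 : edge_weight 4 4 = 512 / 27.
Proof. by rewrite /edge_weight; field. Qed.

Definition edge_weightE :=
  (edge_weight2, fun j => edge_weightC j.+3 2, edge_weight33, edge_weight34,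
   edge_weightC 4 3, edge_weight44).

(* The chains with three and four squares determine these constants, which are
   kept folded because conversion would compare unary numerals. *)
Definition AZI_short_ext : rat := 3829 / 4000.
Definition AZI_short_int : rat := 2312 / 3375.
Definition AZI_excess : rat := 11809 / 8000.
Definition AZI_slope : rat := 4456 / 125.
Definition AZI_offset : rat := (26 * 1000 + 763) / 2000.

Lemma AZI_short_int_gt0 : 0 < AZI_short_int.
Proof. by rewrite /AZI_short_int; lra. Qed.

Lemma AZI_short_int_lt_ext : AZI_short_int < AZI_short_ext.
Proof. by rewrite /AZI_short_int /AZI_short_ext; lra. Qed.

Lemma AZI_short_int_lt_excess : AZI_short_int < AZI_excess.
Proof. by rewrite /AZI_short_int /AZI_excess; lra. Qed.

Lemma AZI_short_walk (p : point) (d : bool) (t : seq bool) : (0 < size t <= 2)%N ->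
  degree_index edge_weight (turning_walk p d t)
  = affine_index AZI_slope AZI_offset (size t).+2
    - turn_cost AZI_short_ext AZI_short_int AZI_excess t.
Proof.
rewrite degree_index_walk degree_index_edge_degrees.
rewrite /affine_index /AZI_slope /AZI_offset.
case: t => [|a [|b [|? ?]]] short_t; try discriminate short_t.
- case: d a short_t => -[] _; set degs := edge_degrees _; vm_compute in degs;
  rewrite /degs !big_cons big_nil /= ?edge_weightE /AZI_short_ext; lra.
- case: d a b short_t => -[] [] _; set degs := edge_degrees _; vm_compute in degs;
  rewrite /degs !big_cons big_nil /= ?edge_weightE;
  rewrite /pair_cost /= /AZI_short_ext /AZI_short_int /AZI_excess; lra.
Qed.

Lemma maxAZIE (n : nat) : maxAZI n = max_index AZI_short_int AZI_slope AZI_offset n.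
Proof.
rewrite /max_index -(mulr_natr AZI_short_int) /affine_index /maxAZI.
congr (_ - _).
Qed.

Lemma AZI_le_max (n : nat) (c : chain) :
  (2 < n)%N -> polyomino_chain n c -> AZI c <= maxAZI n.
Proof.
move=> n_gt2 c_n; rewrite maxAZIE AZI_degree_index.
exact: (degree_index_le_max AZI_short_walk AZI_short_int_gt0 AZI_short_int_lt_ext
          AZI_short_int_lt_excess n_gt2 c_n).
Qed.

Lemma AZI_optimal_turns (n : nat) :
  (4 < n)%N -> AZI (staircase (optimal_turns n)) = maxAZI n.
Proof.
move=> n_gt4; rewrite maxAZIE AZI_degree_index.
exact: (degree_index_optimal_turns AZI_short_walk n_gt4).
Qed.

Lemma AZI_eq_max_odd (n : nat) (c : chain) : (2 < n)%N -> odd n ->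
  polyomino_chain n c -> AZI c = maxAZI n <-> regular c.
Proof.
move=> n_gt2 n_odd c_n; rewrite maxAZIE AZI_degree_index.
exact: (degree_index_eq_max_odd AZI_short_walk AZI_short_int_gt0
          AZI_short_int_lt_ext AZI_short_int_lt_excess n_gt2 n_odd c_n).
Qed.

Lemma AZI_eq_max_even (n : nat) (c : chain) : (2 < n)%N -> ~~ odd n ->
  polyomino_chain n c -> AZI c = maxAZI n <-> one_short_internal c.
Proof.
move=> n_gt2 n_even c_n; rewrite maxAZIE AZI_degree_index.
exact: (degree_index_eq_max_even AZI_short_walk AZI_short_int_gt0
          AZI_short_int_lt_ext AZI_short_int_lt_excess n_gt2 n_even c_n).
Qed.

Lemma maximizes_AZIP (n : nat) (c : chain) : (4 < n)%N ->
  maximizes_AZI n c <-> polyomino_chain n c /\ AZI c = maxAZI n.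
Proof.
move=> n_gt4; have n_gt2 : (2 < n)%N by exact: ltn_trans n_gt4.
split=> -[c_n c_max]; (split; first exact: c_n); last first.
  by move=> c' c'_n; rewrite c_max; exact: AZI_le_max.
apply: le_anti; apply/andP; split; first exact: AZI_le_max.
by rewrite -(AZI_optimal_turns n_gt4); apply: c_max; exact: optimal_turns_polyomino.
Qed.

Lemma maximizes_AZI_optimal_turns (n : nat) :
  (4 < n)%N -> maximizes_AZI n (staircase (optimal_turns n)).
Proof.
move=> n_gt4; apply/maximizes_AZIP; first exact: n_gt4.
exact: conj (optimal_turns_polyomino n_gt4) (AZI_optimal_turns n_gt4).
Qed.

Lemma maximizes_AZI_odd (n : nat) (c : chain) : (4 < n)%N -> odd n ->
  maximizes_AZI n c <-> polyomino_chain n c /\ regular c.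
Proof.
move=> n_gt4 n_odd; have n_gt2 : (2 < n)%N by exact: ltn_trans n_gt4.
rewrite (maximizes_AZIP c n_gt4); split=> -[c_n].
  by move/(iffLR (AZI_eq_max_odd n_gt2 n_odd c_n)); exact: conj.
by move/(iffRL (AZI_eq_max_odd n_gt2 n_odd c_n)); exact: conj.
Qed.

Lemma maximizes_AZI_even (n : nat) (c : chain) : (4 < n)%N -> ~~ odd n ->
  maximizes_AZI n c <-> polyomino_chain n c /\ one_short_internal c.
Proof.
move=> n_gt4 n_even; have n_gt2 : (2 < n)%N by exact: ltn_trans n_gt4.
rewrite (maximizes_AZIP c n_gt4); split=> -[c_n].
  by move/(iffLR (AZI_eq_max_even n_gt2 n_even c_n)); exact: conj.
by move/(iffRL (AZI_eq_max_even n_gt2 n_even c_n)); exact: conj.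
Qed.

Lemma maximizes_AZI_unique (n : nat) (c c' : chain) : (4 < n)%N -> odd n ->
  maximizes_AZI n c -> maximizes_AZI n c' -> c = c'.
Proof.
move=> n_gt4 n_odd; have n_gt2 : (2 < n)%N by exact: ltn_trans n_gt4.
move=> /(maximizes_AZI_odd _ n_gt4 n_odd)[c_n c_reg].
move=> /(maximizes_AZI_odd _ n_gt4 n_odd)[c'_n c'_reg].
exact: regular_unique n_gt2 c_n c'_n c_reg c'_reg.
Qed.

End AugmentedZagreb.

Theorem theorem3 (n : nat) (hn : 5 <= n) :
  [/\ odd n ->
        exists c : chain, unique (AZ1 ((n - 1) %/ 2)) c
          /\ forall c' : chain, maximizes_AZI n c' <-> c' = c,
      ~~ odd n ->
        forall c : chain, maximizes_AZI n c <-> AZ2 (n %/ 2) c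
    & exists2 c : chain, maximizes_AZI n c & AZI c = maxAZI n].
Proof.
pose best := staircase (optimal_turns n).
have best_max : maximizes_AZI n best by exact: maximizes_AZI_optimal_turns.
split=> [n_odd|n_even c|].
- have AZ1_max c : AZ1 ((n - 1) %/ 2) c <-> maximizes_AZI n c.
    rewrite AZ1P maximizes_AZI_odd // (_ : _.*2.+1 = n) //; lia.
  exists best; split=> [|c].
    by split=> [|c /AZ1_max]; [exact/AZ1_max | exact: maximizes_AZI_unique].
  by split=> [c_max|->] //; exact: maximizes_AZI_unique c_max best_max.
- by rewrite AZ2P maximizes_AZI_even // (_ : _.*2 = n) //; lia.
- by exists best; last exact: AZI_optimal_turns.
Qed.
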